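(* Let $d \geq 1$ be an integer and let $f(z) = \sum_{i=0}^d a_i z^i$, where the $a_i$ are indeterminates. Let $\phi \colon \mathbb{Z}_{\geq 1} \to \mathbb{Z}_{\geq 0}$ be a function, and let $Z_N$ be the formal series that is the sum of the weights $w(T)$ of all rooted plane trees $T$ with $\mathrm{iter}_\phi(T) \leq N$ (as defined in the context; $Z_N = 0$ for $N<0$). Suppose that the image of $\phi$ is $[0,L] = \{0,1,\ldots,L\}$ for some integer $L \geq 1$, and also that $\phi^{-1}(\{0\}) = \{1\}$. Then for every integer $N \geq 0$, \[ Z_N = Z_{N-1} - \frac{f(Z_{N-L})+ \sum_{k=1}^{L-1} \sum_{r \in \phi^{-1}([0,k])} (Z_{N-k} - Z_{N-k-1})^r \, \frac{f^{(r)}(Z_{N-k-1})}{r!}}{f'(Z_{N-1})}. \]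
   Context: For integers $a \leq b$, $[a,b] = \{ i \in \mathbb{Z} : a \leq i \leq b\}$. Fix an integer $d \geq 1$ and indeterminates $a_0, a_1, \ldots, a_d$; set $a_i = 0$ for $i > d$. All identities take place in the ring of formal series $R = \mathbb{Q}[a_1, a_1^{-1}, a_2, \ldots, a_d][[a_0]]$, and infinite sums are taken in the $a_0$-adic sense. The polynomial $f(z)=\sum_{i=0}^d a_i z^i$ defines a function $R \to R$; $f^{(r)}$ is its $r$-th derivative in $z$ (zero for $r>d$), and $f' = f^{(1)}$. Division by $f'(Z_{N-1})$ means multiplication by its inverse in $R$ (its constant term in $a_0$ is the unit $a_1$). Rooted plane trees are defined recursively: a rooted plane tree $T$ is either a single vertex, denoted by the empty sequence $T = ()$, or an ordered sequence $T = (T_1, \ldots, T_l)$ of rooted plane trees with $l \geq 2$. Let $\mathrm{RootedPlaneTrees}$ be the set of all of them. The weight $w(T)$ is \[ w(()) = -\frac{a_0}{a_1}, \qquad w((T_1,\ldots,T_l)) = -\frac{a_l}{a_1} \prod_{i=1}^l w(T_i). \] Given $\phi \colon \mathbb{Z}_{\geq 1} \to \mathbb{Z}_{\geq 0}$, the iteration number $\mathrm{iter}_\phi(T)$ is defined recursively by $\mathrm{iter}_\phi(()) = 0$ and, for $T = (T_1,\ldots,T_l)$, \[ \mathrm{iter}_\phi(T) = \mathrm{max}_\phi(T) + \phi(\mathrm{maxMult}_\phi(T)), \] where $\mathrm{max}_\phi(T) = \max\{\mathrm{iter}_\phi(T_i) : 1 \leq i \leq l\}$ and $\mathrm{maxMult}_\phi(T)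 = \#\{ i : 1 \leq i \leq l,\ \mathrm{iter}_\phi(T_i) = \mathrm{max}_\phi(T)\}$. For an integer $N$, \[ Z_N = \sum_{\substack{T \in \mathrm{RootedPlaneTrees} \\ \mathrm{iter}_\phi(T) \leq N}} w(T) \in R, \] so $Z_N = 0$ for $N < 0$ (empty sum). An empty sum (e.g. $\sum_{k=1}^{L-1}$ when $L=1$) is $0$. *)

(* Defs.v *)
From HB Require Import structures.
From mathcomp Require Import all_boot all_order all_algebra.
From mathcomp Require Import boolp classical_sets.
From mathcomp Require Import mpoly.

Set Implicit Arguments.
Unset Strict Implicit.
Unset Printing Implicit Defensive.

Import Order.TTheory GRing.Theory Num.Theory.

Local Open Scope ring_scope.

Record fps (A : Type) := Fps { fpscoef : nat -> A }.

Notation "{ 'fps' A }" := (fps A) (format "{ 'fps'  A }").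

HB.instance Definition _ (A : Type) := gen_eqMixin {fps A}.
HB.instance Definition _ (A : Type) := gen_choiceMixin {fps A}.

Section FpsRing.
Variable A : comNzRingType.
Implicit Types f g h : {fps A}.

Lemma fpsP f g : (forall n, fpscoef f n = fpscoef g n) -> f = g.
Proof. by case: f => f; case: g => g /= fg; congr Fps; apply/funext. Qed.

Definition fps_zero : {fps A} := Fps (fun _ => 0).
Definition fps_opp f : {fps A} := Fps (fun n => - fpscoef f n).
Definition fps_add f g : {fps A} := Fps (fun n => fpscoef f n + fpscoef g n).
Definition fps_one : {fps A} := Fps (fun n => (n == 0%N)%:R).
Definition fps_mul f g : {fps A} :=
  Fps (fun n => \sum_(i < n.+1) fpscoef f i * fpscoef g (n - i)).

Lemma fps_addA : associative fps_add.
Proof. by move=> f g h; apply: fpsP => n /=; rewrite addrA. Qed.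
Lemma fps_addC : commutative fps_add.
Proof. by move=> f g; apply: fpsP => n /=; rewrite addrC. Qed.
Lemma fps_add0 : left_id fps_zero fps_add.
Proof. by move=> f; apply: fpsP => n /=; rewrite add0r. Qed.
Lemma fps_addN : left_inverse fps_zero fps_opp fps_add.
Proof. by move=> f; apply: fpsP => n /=; rewrite addNr. Qed.

HB.instance Definition _ := GRing.isZmodule.Build {fps A}
  fps_addA fps_addC fps_add0 fps_addN.

Definition fps_trunc (m : nat) f : {poly A} := \poly_(i < m) fpscoef f i.

Lemma fps_mul_trunc (m n : nat) f g : (n < m)%N ->
  fpscoef (fps_mul f g) n = (fps_trunc m f * fps_trunc m g)`_n.
Proof.
move=> nm; rewrite coefM /=; apply: eq_bigr => i _.
rewrite !coef_poly (leq_ltn_trans _ nm) ?leq_ord //.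
by rewrite (leq_ltn_trans (leq_subr _ _) nm).
Qed.

Lemma fps_mulA : associative fps_mul.
Proof.
move=> f g h; apply: fpsP => n.
transitivity (fps_trunc n.+1 f * (fps_trunc n.+1 g * fps_trunc n.+1 h))`_n.
  rewrite coefM /=; apply: eq_bigr => i _; rewrite coef_poly ltn_ord.
  by congr (_ * _); apply: fps_mul_trunc; rewrite ltnS leq_subr.
rewrite mulrA coefM /=; apply: eq_bigr => i _.
rewrite [X in _ * X = _]coef_poly ltnS leq_subr; congr (_ * _).
by rewrite -fps_mul_trunc.
Qed.

Lemma fps_mulC : commutative fps_mul.
Proof.
move=> f g; apply: fpsP => n.
by rewrite !(@fps_mul_trunc n.+1) // mulrC.
Qed.

Lemma fps_mul1 : left_id fps_one fps_mul.
Proof.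
move=> f; apply: fpsP => n /=.
rewrite big_ord_recl /= subn0 mul1r big1 ?addr0 // => i _.
by rewrite /= mul0r.
Qed.

Lemma fps_mulDl : left_distributive fps_mul fps_add.
Proof.
move=> f g h; apply: fpsP => n /=.
by rewrite -big_split; apply: eq_bigr => i _; rewrite mulrDl.
Qed.

Lemma fps_1neq0 : fps_one != 0.
Proof.
apply/eqP => /(congr1 (fun f => fpscoef f 0)) /= /eqP.
by rewrite oner_eq0.
Qed.

HB.instance Definition _ := GRing.Zmodule_isComNzRing.Build {fps A}
  fps_mulA fps_mulC fps_mul1 fps_mulDl fps_1neq0.

Lemma fpscoef0 n : fpscoef (0 : {fps A}) n = 0. Proof. by []. Qed.
Lemma fpscoef1 n : fpscoef (1 : {fps A}) n = (n == 0%N)%:R. Proof. by []. Qed.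
Lemma fpscoefN f n : fpscoef (- f) n = - fpscoef f n. Proof. by []. Qed.
Lemma fpscoefD f g n : fpscoef (f + g) n = fpscoef f n + fpscoef g n.
Proof. by []. Qed.
Lemma fpscoefM f g n :
  fpscoef (f * g) n = \sum_(i < n.+1) fpscoef f i * fpscoef g (n - i).
Proof. by []. Qed.

Lemma fpscoef_sum (I : Type) (r : seq I) (P : pred I) (F : I -> {fps A}) n :
  fpscoef (\sum_(i <- r | P i) F i) n = \sum_(i <- r | P i) fpscoef (F i) n.
Proof. exact: (big_morph (fun f => fpscoef f n)). Qed.

Definition fps_unit : {pred {fps A}} := fun f => `[< exists g, g * f = 1 >].

Definition fps_inv f : {fps A} :=
  if pselect (exists g, g * f = 1) is left h then projT1 (cid h) else f.

Lemma fps_mulVr : {in fps_unit, left_inverse 1 fps_inv *%R}.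
Proof.
move=> f /asboolP uf; rewrite /fps_inv; case: pselect => // h.
by case: cid.
Qed.

Lemma fps_unitPl f g : g * f = 1 -> fps_unit f.
Proof. by move=> gf; apply/asboolP; exists g. Qed.

Lemma fps_invr_out : {in [predC fps_unit], fps_inv =1 id}.
Proof.
by move=> f /asboolPn nuf; rewrite /fps_inv; case: pselect.
Qed.

HB.instance Definition _ := GRing.ComNzRing_hasMulInverse.Build {fps A}
  fps_mulVr fps_unitPl fps_invr_out.

Fixpoint fps_inv_seq (f : {fps A}) (c : A) (n : nat) : seq A :=
  if n is m.+1 then
    let s := fps_inv_seq f c m in
    rcons s (c * ((m == 0%N)%:R - \sum_(i < m) fpscoef f (m - i) * s`_i))
  else [::].

Lemma fps_inv_seqE f c n : size (fps_inv_seq f c n) = n /\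
  forall i, (i < n)%N -> (fps_inv_seq f c n)`_i = (fps_inv_seq f c i.+1)`_i.
Proof.
elim: n => [|n [sn IHn]]; split=> //=; first by rewrite size_rcons sn.
move=> i; rewrite ltnS leq_eqVlt => /orP[/eqP -> //|lt_in].
by rewrite nth_rcons sn lt_in IHn.
Qed.

Lemma fps_unitP f :
  reflect (exists c, c * fpscoef f 0 = 1) (f \is a GRing.unit).
Proof.
apply: (iffP idP) => [uf|[c cf]].
  exists (fpscoef f^-1 0); have := congr1 (fun f => fpscoef f 0) (mulVr uf).
  by rewrite fpscoefM big_ord_recl big_ord0 addr0.
pose g : {fps A} := Fps (fun n => (fps_inv_seq f c n.+1)`_n).
suff gf : g * f = 1 by apply/asboolP; exists g.
apply: fpsP => n; rewrite fpscoefM fpscoef1 big_ord_recr /= subnn.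
have [sn En] := fps_inv_seqE f c n.
rewrite nth_rcons sn ltnn eqxx mulrAC cf mul1r addrC -addrA -[RHS]addr0.
congr (_ + _); apply/eqP; rewrite addrC subr_eq0; apply/eqP/eq_bigr => i _.
by rewrite En // mulrC.
Qed.

Definition fpsC (c : A) : {fps A} := Fps (fun n => if n is 0 then c else 0).

Definition fpsX : {fps A} := Fps (fun n => (n == 1%N)%:R).

(* [adic_sum_to P F s]: the net of the finite partial sums of (F i), i in P,
   converges to s in the adic topology. *)
Definition adic_sum_to (I : eqType) (P : pred I) (F : I -> {fps A})
    (s : {fps A}) : Prop :=
  forall n : nat, exists J0 : seq I, forall J : seq I,
    uniq J -> {subset J0 <= J} ->
    forall k, (k < n)%N -> fpscoef (\sum_(i <- J | P i) F i) k = fpscoef s k.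

(* The value is 0 when the family is not summable. *)
Definition adic_sum (I : eqType) (P : pred I) (F : I -> {fps A}) : {fps A} :=
  xget 0 [set s | adic_sum_to P F s].

Lemma adic_sum_to_unique (I : eqType) (P : pred I) (F : I -> {fps A}) s t :
  adic_sum_to P F s -> adic_sum_to P F t -> s = t.
Proof.
move=> Fs Ft; apply: fpsP => n.
have [J1 J1s] := Fs n.+1; have [J2 J2t] := Ft n.+1.
rewrite -(J1s (undup (J1 ++ J2))) ?undup_uniq //; last first.
  by move=> i iJ; rewrite mem_undup mem_cat iJ.
rewrite -(J2t (undup (J1 ++ J2))) ?undup_uniq // => i iJ.
by rewrite mem_undup mem_cat iJ orbT.
Qed.

Lemma adic_sumE (I : eqType) (P : pred I) (F : I -> {fps A}) s :
  adic_sum_to P F s -> adic_sum P F = s.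
Proof.
move=> Fs; apply: (adic_sum_to_unique _ Fs).
by rewrite /adic_sum; case: xgetP => [? -> //|/(_ s)].
Qed.

Lemma adic_summable (I : eqType) (P : pred I) (F : I -> {fps A}) :
  (forall n, exists J0 : seq I,
     forall i, P i -> i \notin J0 -> fpscoef (F i) n = 0) ->
  adic_sum_to P F (adic_sum P F).
Proof.
move=> /choice[J0 J0P].
pose s : {fps A} :=
  Fps (fun n => \sum_(i <- undup (J0 n) | P i) fpscoef (F i) n).
suff Fs : adic_sum_to P F s by rewrite (adic_sumE Fs).
move=> n; exists (flatten [seq J0 k | k <- iota 0 n]) => J uJ sJ k kn.
have sJk : {subset undup (J0 k) <= J}.
  move=> i; rewrite mem_undup => iJ; apply: sJ; apply/flattenP.
  by exists (J0 k) => //; apply: map_f; rewrite mem_iota.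
rewrite fpscoef_sum /= (bigID (fun i => i \in J0 k)) /= [X in _ + X]big1 ?addr0.
  rewrite -[RHS]big_filter -big_filter; apply: perm_big.
  apply: uniq_perm; rewrite ?filter_uniq ?undup_uniq // => i.
  rewrite !mem_filter mem_undup -andbA; congr (_ && _).
  by apply: andb_idr => iJ; apply: sJk; rewrite mem_undup.
by move=> i /andP[Pi iJ]; exact: J0P.
Qed.

End FpsRing.

Arguments fpscoef : simpl never.

Notation "\asum_ ( i | P ) F" := (adic_sum (fun i => P) (fun i => F))
  (at level 41, F at level 41, i at level 50,
   format "'[' \asum_ ( i  |  P ) '/  '  F ']'") : ring_scope.

(* All finite plane trees; rooted plane trees in the sense used here are those
   without a vertex having exactly one child.  The single vertex () is
   [PlaneTree [::]]. *)
Inductive plane_tree := PlaneTree of seq plane_tree.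

Fixpoint is_rpt (T : plane_tree) : bool :=
  let: PlaneTree Ts := T in (size Ts != 1) && all is_rpt Ts.

Lemma plane_tree_ind' (Q : plane_tree -> Prop) :
  (forall Ts, foldr (fun T => and (Q T)) True Ts -> Q (PlaneTree Ts)) ->
  forall T, Q T.
Proof.
move=> QT; fix IH 1 => -[Ts]; apply: QT.
by elim: Ts => //= T Ts IHTs; split.
Qed.

Fixpoint plane_tree_encode (T : plane_tree) : GenTree.tree unit :=
  let: PlaneTree Ts := T in GenTree.Node 0 (map plane_tree_encode Ts).

Fixpoint plane_tree_decode (T : GenTree.tree unit) : plane_tree :=
  if T is GenTree.Node _ Ts then PlaneTree (map plane_tree_decode Ts)
  else PlaneTree [::].

Lemma plane_tree_encodeK : cancel plane_tree_encode plane_tree_decode.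
Proof.
elim/plane_tree_ind' => Ts /= IH; congr PlaneTree.
by elim: Ts IH => //= T Ts IHTs [-> /IHTs ->].
Qed.

HB.instance Definition _ :=
  Countable.copy plane_tree (can_type plane_tree_encodeK).

Lemma plane_tree_indP (Q : plane_tree -> Prop) :
  (forall Ts, {in Ts, forall T, Q T} -> Q (PlaneTree Ts)) -> forall T, Q T.
Proof.
move=> QT; elim/plane_tree_ind' => Ts IH; apply: QT.
elim: Ts IH => //= T Ts IHTs [QT1 /IHTs QTs] U.
by rewrite inE => /orP[/eqP ->|/QTs].
Qed.

(* For the single vertex, the formula reads - a_0 / a_1. *)
Fixpoint weight (R : comUnitRingType) (a : nat -> R) (T : plane_tree) : R :=
  let: PlaneTree Ts := T in
  - (a (size Ts) / a 1%N) * \prod_(x <- map (weight a) Ts) x.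

(* phi is only evaluated at positive integers: its value at 0 is irrelevant. *)
Fixpoint iter_num (phi : nat -> nat) (T : plane_tree) : nat :=
  let: PlaneTree Ts := T in
  if Ts is [::] then 0%N else
  let its := map (iter_num phi) Ts in
  let m := \max_(i <- its) i in
  (m + phi (count_mem m its))%N.

Fixpoint leaves (T : plane_tree) : nat :=
  let: PlaneTree Ts := T in
  if Ts is [::] then 1%N else sumn (map leaves Ts).

Lemma leaves_gt0 T : (0 < leaves T)%N.
Proof.
elim/plane_tree_indP: T => -[//|T Ts] IH /=.
by rewrite addn_gt0 IH ?mem_head.
Qed.

Lemma size_le_leaves Ts : (size Ts <= sumn (map leaves Ts))%N.
Proof.
by elim: Ts => //= T Ts IH; rewrite -add1n leq_add // leaves_gt0.
Qed.

Lemma finite_seqs (I : eqType) (J : seq I) (n : nat) :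
  exists L : seq (seq I), forall s,
    (size s <= n)%N -> {subset s <= J} -> s \in L.
Proof.
elim: n => [|n [L HL]].
  by exists [:: [::]] => -[|//] _ _; rewrite inE.
exists ([::] :: [seq x :: s | x <- J, s <- L]) => -[|x s] /= ss sJ.
  by rewrite inE.
rewrite inE /=; apply: allpairs_f; first by apply: sJ; rewrite mem_head.
by apply: HL => // y ys; apply: sJ; rewrite inE ys orbT.
Qed.

Lemma finite_rpt (n : nat) : exists J : seq plane_tree,
  forall T, is_rpt T -> (leaves T <= n)%N -> T \in J.
Proof.
elim: n => [|n [J HJ]].
  by exists [::] => T _; rewrite leqNgt leaves_gt0.
have [L HL] := finite_seqs J n.+1.
exists (PlaneTree [::] :: map PlaneTree L) => -[Ts] /= /andP[sTs /allP rTs].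
case: Ts => [|T1 [//|T2 Ts]] in sTs rTs *; first by rewrite mem_head.
move=> lTs; rewrite inE; apply/orP; right; apply: map_f.
apply: HL; first exact: leq_trans (size_le_leaves _) lTs.
move=> T TTs; apply: HJ; first exact: rTs.
rewrite -ltnS; apply: leq_trans lTs.
have perm := perm_to_rem TTs.
set U := [:: T1, T2 & Ts] in TTs perm *.
rewrite -[X in (_ < X)%N]/(sumn (map leaves U)).
have sr : (0 < size (rem T U))%N by rewrite size_rem.
rewrite (perm_sumn (perm_map leaves perm)).
rewrite -[X in (_ < X)%N]/(leaves T + sumn (map leaves (rem T U)))%N.
by rewrite -[X in (X < _)%N]addn0 ltn_add2l (leq_trans sr) // size_le_leaves.
Qed.

Section TreeSeries.
Variables (A : comNzRingType) (a : nat -> {fps A}) (phi : nat -> nat).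

Definition tree_series (N : int) : {fps A} :=
  \asum_(T | is_rpt T && ((iter_num phi T)%:Z <= N)) weight a T.

Lemma fpscoefM_eq0 (f g : {fps A}) m n k :
  (forall i, (i < m)%N -> fpscoef f i = 0) ->
  (forall i, (i < n)%N -> fpscoef g i = 0) ->
  (k < m + n)%N -> fpscoef (f * g) k = 0.
Proof.
move=> f0 g0 kmn; rewrite fpscoefM big1 // => i _.
have [im|mi] := ltnP i m; first by rewrite f0 // mul0r.
rewrite g0 ?mulr0 // -(ltn_add2l i) subnKC -?[(i <= k)%N]ltnS //.
by apply: leq_trans kmn _; rewrite leq_add2r.
Qed.

Lemma weight_coef_eq0 T k :
  fpscoef (a 0%N) 0 = 0 -> (k < leaves T)%N -> fpscoef (weight a T) k = 0.
Proof.
move=> a00; elim/plane_tree_indP: T k => Ts IH k.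
case: Ts IH => [|T Ts] IH.
  rewrite /= big_nil mulr1 ltnS leqn0 => /eqP ->.
  by rewrite fpscoefN fpscoefM big_ord_recl big_ord0 a00 mul0r addr0 oppr0.
move=> kl; rewrite /weight -/(weight a).
apply: (@fpscoefM_eq0 _ _ 0 (leaves (PlaneTree (T :: Ts)))) => // {k kl}.
rewrite -[leaves _]/(sumn (map leaves (T :: Ts))).
elim: (T :: Ts) IH => //= {T Ts} T Ts IHTs IH i il.
rewrite big_cons; apply: fpscoefM_eq0 il => j jl.
  by apply: IH => //; rewrite mem_head.
by apply: IHTs => // U UTs; apply: IH; rewrite inE UTs orbT.
Qed.

Lemma tree_series_summable (N : int) : fpscoef (a 0%N) 0 = 0 ->
  adic_sum_to (fun T => is_rpt T && ((iter_num phi T)%:Z <= N)) (weight a)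
    (tree_series N).
Proof.
move=> a00; apply: adic_summable => n; have [J JP] := finite_rpt n.
exists J => T /andP[rT _] TJ; apply: weight_coef_eq0 => //.
by rewrite ltnNge; apply: contra TJ; exact: JP.
Qed.

Lemma tree_series_coef0 (N : int) : fpscoef (a 0%N) 0 = 0 ->
  fpscoef (tree_series N) 0 = 0.
Proof.
move=> a00; have [J /(_ (undup J)) JP] := tree_series_summable N a00 1.
rewrite -JP ?undup_uniq // => [|i]; last by rewrite mem_undup.
by rewrite fpscoef_sum big1 // => T _; rewrite weight_coef_eq0 ?leaves_gt0.
Qed.

Lemma tree_series_neg (N : int) : N < 0 -> tree_series N = 0.
Proof.
move=> N0; apply: adic_sumE => n; exists [::] => J _ _ k _.
rewrite big1 // => T /andP[_ TN].
by have := le_lt_trans TN N0; rewrite ltNge.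
Qed.

End TreeSeries.

(* The coefficient ring Q[a_1, a_1^-1, a_2, ..., a_d], realized inside the
   fraction field of Q[a_1, ..., a_d] as the subring of the x such that
   a_1^k x is a polynomial for some k.  The variable 'X_j of {mpoly rat[d]},
   0 <= j < d, stands for a_(j+1). *)

Definition mvar (d i : nat) : {mpoly rat[d]} :=
  if insub i.-1 is Some j then 'X_j else 0.

Definition is_laurent (d : nat) : {pred {fraction {mpoly rat[d]}}} :=
  fun x => `[< exists (k : nat) (p : {mpoly rat[d]}),
                 tofrac (mvar d 1) ^+ k * x = tofrac p >].

Lemma is_laurent_subring (d : nat) : subring_closed (@is_laurent d).
Proof.
split=> [|x y|x y]; first by apply/asboolP; exists 0%N, 1; rewrite mul1r rmorph1.
  move=> /asboolP[k [p xp]] /asboolP[l [q yq]]; apply/asboolP.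
  exists (k + l)%N, (mvar d 1 ^+ l * p - mvar d 1 ^+ k * q).
  rewrite rmorphB !rmorphM !rmorphXn /= -xp -yq exprD mulrBr !mulrA.
  by rewrite [X in X * x]mulrC.
move=> /asboolP[k [p xp]] /asboolP[l [q yq]]; apply/asboolP.
by exists (k + l)%N, (p * q); rewrite rmorphM /= -xp -yq exprD mulrACA.
Qed.

HB.instance Definition _ (d : nat) :=
  GRing.isSubringClosed.Build _ (@is_laurent d) (@is_laurent_subring d).

Record laurent (d : nat) := Laurent {
  laurent_val :> {fraction {mpoly rat[d]}};
  _ : laurent_val \in @is_laurent d
}.

HB.instance Definition _ (d : nat) := [isSub for @laurent_val d].
HB.instance Definition _ (d : nat) := [Choice of laurent d by <:].
HB.instance Definition _ (d : nat) :=
  [SubChoice_isSubComNzRing of laurent d by <:].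

Lemma tofrac_is_laurent (d : nat) (p : {mpoly rat[d]}) :
  tofrac p \in @is_laurent d.
Proof. by apply/asboolP; exists 0%N, p; rewrite mul1r. Qed.

Definition laurent_of_mpoly (d : nat) (p : {mpoly rat[d]}) : laurent d :=
  Laurent (tofrac_is_laurent p).

Notation series_ring d := {fps (laurent d)}.

(* The series variable is a_0. *)
Definition indet (d i : nat) : series_ring d :=
  if i == 0%N then fpsX (laurent d)
  else if (i <= d)%N then fpsC (laurent_of_mpoly (mvar d i))
  else 0.

Definition gen_poly (d : nat) : {poly series_ring d} :=
  \poly_(i < d.+1) indet d i.

Definition Zser (d : nat) (phi : nat -> nat) (N : int) : series_ring d :=
  tree_series (indet d) phi N.

(* The divisors occurring in the recurrence are units of the series ring, so
   that _ / _ really is multiplication by the inverse. *)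

Lemma laurent_of_mpolyM (d : nat) (p q : {mpoly rat[d]}) :
  laurent_of_mpoly (p * q) = laurent_of_mpoly p * laurent_of_mpoly q.
Proof. by apply: val_inj; rewrite /= rmorphM. Qed.

Lemma laurent_of_mpoly1 (d : nat) : laurent_of_mpoly (1 : {mpoly rat[d]}) = 1.
Proof. by apply: val_inj; rewrite /= rmorph1. Qed.

Lemma laurent_of_mpoly_nat (d n : nat) :
  laurent_of_mpoly (n%:R : {mpoly rat[d]}) = n%:R.
Proof.
apply: val_inj; rewrite [RHS](rmorph_nat (val : laurent d -> _)) /=.
exact: rmorph_nat.
Qed.

Lemma mvar_neq0 (d i : nat) : (0 < i <= d)%N -> mvar d i != 0.
Proof.
case: i => [//|i] /= id; rewrite /mvar /=; case: insubP => [j _ _|].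
  apply/eqP => /(congr1 (fun p => p@_(U_(j)))) /eqP.
  by rewrite mcoeffX eqxx mcoeff0 oner_eq0.
by rewrite id.
Qed.

Lemma laurent_a1_inv (d : nat) : (0 < d)%N ->
  exists c : laurent d, c * laurent_of_mpoly (mvar d 1) = 1.
Proof.
move=> d0; have nz : tofrac (mvar d 1) != 0.
  by rewrite tofrac_eq0 mvar_neq0.
have Hc : (tofrac (mvar d 1))^-1 \in @is_laurent d.
  by apply/asboolP; exists 1%N, 1; rewrite expr1 mulfV // rmorph1.
by exists (Laurent Hc); apply: val_inj; rewrite /= mulVf.
Qed.

Lemma fact_unit (d n : nat) : (n`!%:R : series_ring d) \is a GRing.unit.
Proof.
have cn : fpscoef (n`!%:R : series_ring d) 0 = n`!%:R.
  by elim: n`! => // m IH; rewrite -addn1 !natrD -IH.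
apply/fps_unitP; exists (laurent_of_mpoly (((n`!%:R)^-1)%:MP)).
rewrite cn -laurent_of_mpoly_nat -laurent_of_mpolyM -laurent_of_mpoly1.
congr laurent_of_mpoly.
rewrite -(rmorph_nat (@mpolyC d rat)) -rmorphM /= mulVf ?rmorph1 //.
by rewrite pnatr_eq0 -lt0n fact_gt0.
Qed.

Lemma fpscoef0M (A : comNzRingType) (f g : {fps A}) :
  fpscoef (f * g) 0 = fpscoef f 0 * fpscoef g 0.
Proof. by rewrite fpscoefM big_ord_recl big_ord0 addr0. Qed.

Lemma deriv_gen_poly_unit (d : nat) (phi : nat -> nat) (N : int) : (0 < d)%N ->
  (gen_poly d)^`().[Zser d phi N] \is a GRing.unit.
Proof.
move=> d0; have [c c1] := laurent_a1_inv d0; apply/fps_unitP; exists c.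
have Z0 : fpscoef (Zser d phi N) 0 = 0 by exact: tree_series_coef0.
rewrite -c1; congr (_ * _).
suff -> : fpscoef (gen_poly d)^`().[Zser d phi N] 0
        = fpscoef ((gen_poly d)^`())`_0 0.
  by rewrite coef_deriv mulr1n coef_poly !ltnS d0 /indet /= d0.
elim/poly_ind: (gen_poly d)^`() => [|p q _]; first by rewrite horner0 coef0.
by rewrite hornerMXaddC coefD coefMX coefC !fpscoefD fpscoef0M Z0 mulr0.
Qed.

Lemma taylor_summable (d : nat) (P : pred nat) (x y : series_ring d) :
  let F r := x ^+ r * ((gen_poly d)^`(r).[y] / (r`!)%:R) in
  adic_sum_to P F (adic_sum P F).
Proof.
move=> F; apply: adic_summable => n; exists (iota 0 d.+1) => r _.
rewrite mem_iota /= add0n -leqNgt => dr.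
rewrite /F derivn_poly0 ?horner0 ?mul0r ?mulr0 //.
exact: leq_trans (size_poly _ _) dr.
Qed.

(* Main.v *)
Require Import Defs.
From HB Require Import structures.
From mathcomp Require Import all_boot all_order all_algebra.
From mathcomp Require Import boolp classical_sets.
From mathcomp Require Import mpoly.
From mathcomp Require Import zify.

(* Write D_M = Z_M - Z_(M-1), the sum of the weights of the trees of iteration
   number exactly M, and e_r(M) = D_M^r f^(r)(Z_(M-1)) / r!.  Sorting the trees
   of iteration number N by the number l of children of the root, the maximal
   iteration number M of the children and the number r of children attaining
   it, so that N = M + phi(r), gives
     sum_(r >= 1) e_r(N - phi(r)) = - [N = 0] a_0:
   the children contribute binomial(l, r) D_M^r Z_(M-1)^(l-r), and the term
   l = 1, which no tree provides, is a_1 D_N because phi(1) = 0.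
   Put H(N) = f(Z_N) - sum_r sum_(0 <= k < phi(r)) e_r(N - k).  By Taylor's
   formula f(Z_N) - f(Z_(N-1)) = sum_r e_r(N), so the identity above says that
   H(N) - H(N-1) = - [N = 0] a_0; as H(-1) = f(0) = a_0, H vanishes on N >= 0.
   Telescoping once more, with phi <= L, rewrites H(N) as
     f(Z_(N-L)) + sum_(0 <= k < L) sum_(phi(r) <= k) e_r(N - k),
   whose k = 0 term is D_N f'(Z_(N-1)) since phi^-1(0) = {1}. *)

Set Implicit Arguments.
Unset Strict Implicit.
Unset Printing Implicit Defensive.

Import Order.TTheory GRing.Theory Num.Theory.

Local Open Scope ring_scope.

(** * Congruence of power series modulo a power of the variable, and adic sums with finite
    support *)

Section EqModX.
Variable A : comNzRingType.
Implicit Types f g h : {fps A}.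

Definition eq_modX (n : nat) f g := forall k, (k < n)%N -> fpscoef f k = fpscoef g k.

Lemma eq_modX_refl n f : eq_modX n f f. Proof. by []. Qed.

Lemma eq_modXD n f1 f2 g1 g2 :
  eq_modX n f1 g1 -> eq_modX n f2 g2 -> eq_modX n (f1 + f2) (g1 + g2).
Proof. by move=> e1 e2 k kn; rewrite !fpscoefD e1 // e2. Qed.

Lemma eq_modXM n f1 f2 g1 g2 :
  eq_modX n f1 g1 -> eq_modX n f2 g2 -> eq_modX n (f1 * f2) (g1 * g2).
Proof.
move=> e1 e2 k kn; rewrite !fpscoefM; apply: eq_bigr => i _.
by rewrite e1 ?e2 // (leq_ltn_trans _ kn) ?leq_subr // -ltnS.
Qed.

Lemma eq_modXX n f g m : eq_modX n f g -> eq_modX n (f ^+ m) (g ^+ m).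
Proof.
move=> fg; elim: m => [//|m IH]; rewrite !exprS; exact: eq_modXM.
Qed.

Lemma eq_modX_sum (I : Type) (r : seq I) (P : pred I) (F G : I -> {fps A}) n :
  (forall i, P i -> eq_modX n (F i) (G i)) ->
  eq_modX n (\sum_(i <- r | P i) F i) (\sum_(i <- r | P i) G i).
Proof.
move=> FG k kn; rewrite !fpscoef_sum; apply: eq_bigr => i Pi; exact: FG.
Qed.

Lemma eq_modXMn n f g m : eq_modX n f g -> eq_modX n (f *+ m) (g *+ m).
Proof. by move=> fg; elim: m => [//|m IH]; rewrite !mulrS; apply: eq_modXD. Qed.

(** This turns the sums over the possibly infinite sets phi^-1([0,k]) into finite ones, since only r
    <= d contributes. *)
Lemma adic_sum_finite_support (I : eqType) (P : pred I) (F : I -> {fps A}) J :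
  uniq J -> (forall i, P i -> i \notin J -> F i = 0) ->
  adic_sum P F = \sum_(i <- J | P i) F i.
Proof.
move=> uJ F0; apply: adic_sumE => n; exists J => K uK JK k _.
congr (fpscoef _ k); rewrite (bigID (mem J)) /= [X in _ + X]big1 ?addr0; last first.
  by move=> i /andP[]; exact: F0.
rewrite -[LHS]big_filter -[RHS]big_filter; apply: perm_big.
apply: uniq_perm; rewrite ?filter_uniq // => i; rewrite !mem_filter -andbA.
by congr (_ && _); apply: andb_idr => /JK.
Qed.

End EqModX.

(** * Words over a finite alphabet, and the multiplicity of their maximal level *)

Section Words.
Variable T : eqType.

Fixpoint words (J : seq T) (l : nat) : seq (seq T) :=
  if l is l'.+1 then [seq x :: s | x <- J, s <- words J l'] else [:: [::]].

Lemma mem_words J l s : (s \in words J l) = (size s == l) && all (mem J) s.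
Proof.
elim: l s => [|l IH] s; first by case: s.
apply/allpairsP/idP => [[[x t] /= [xJ]]|].
  by rewrite IH => /andP[sz al] ->; rewrite /= eqSS sz xJ.
case: s => [//|x s] /=; rewrite eqSS => /and3P[sz xJ al].
by exists (x, s); split => //; rewrite IH sz.
Qed.

Lemma words_uniq J l : uniq J -> uniq (words J l).
Proof.
move=> uJ; elim: l => [//|l IH]; apply: allpairs_uniq => //.
by move=> [x s] [y t] _ _ /= [-> ->].
Qed.

Lemma sum_words_prod (R : comPzSemiRingType) J l (F : T -> R) :
  \sum_(s <- words J l) \prod_(x <- s) F x = (\sum_(x <- J) F x) ^+ l.
Proof.
elim: l => [|l IH]; first by rewrite big_seq1 big_nil.
rewrite big_allpairs_dep exprS -IH mulr_suml; apply: eq_bigr => x _.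
by rewrite mulr_sumr; apply: eq_bigr => s _; rewrite big_cons.
Qed.

(* Both sides are the coefficient of 'X^r in the l-th power of the sum over J
   of w x, marked by 'X when Q x holds. *)
Lemma sum_words_count (R : comNzRingType) J l r (P Q : pred T) (w : T -> R) :
  \sum_(s <- words J l | all (predU P Q) s && (count Q s == r))
     \prod_(x <- s) w x =
  ((\sum_(x <- J | Q x) w x) ^+ r *
   (\sum_(x <- J | P x && ~~ Q x) w x) ^+ (l - r)) *+ 'C(l, r).
Proof.
pose F x := if predU P Q x then w x *: 'X^(Q x) else 0 : {poly R}.
have prodF s : \prod_(x <- s) F x =
    if all (predU P Q) s then (\prod_(x <- s) w x) *: 'X^(count Q s) else 0.
  elim: s => [|x s IH]; first by rewrite !big_nil scale1r expr0.
  rewrite !big_cons IH /F /=; case: ifP => _ /=; last by rewrite mul0r.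
  case: ifP => _; last by rewrite mulr0.
  by rewrite -scalerAl -scalerAr scalerA exprD.
have := congr1 (fun p : {poly R} => p`_r) (sum_words_prod J l F).
rewrite coef_sum => E.
transitivity (\sum_(s <- words J l) (\prod_(x <- s) F x)`_r).
  rewrite big_mkcond; apply: eq_bigr => s _; rewrite prodF.
  case: (all _ _) => /=; last by rewrite coef0.
  by rewrite coefZ coefXn [r == _]eq_sym; case: eqP; rewrite ?mulr1 ?mulr0.
rewrite {}E.
have -> : \sum_(x <- J) F x = (\sum_(x <- J | P x && ~~ Q x) w x)%:P +
     (\sum_(x <- J | Q x) w x)%:P * 'X.
  rewrite !rmorph_sum mulr_suml /= [X in X + _]big_mkcond [X in _ + X]big_mkcond.
  rewrite -big_split; apply: eq_bigr => x _; rewrite /F /=.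
  case: (Q x); case: (P x); rewrite /= ?addr0 ?add0r ?expr1 ?expr0 //.
  - by rewrite mul_polyC.
  - by rewrite mul_polyC.
  - by rewrite alg_polyC.
rewrite exprDn coef_sum.
under eq_bigr => i _.
  rewrite exprMn -!rmorphXn /= mulrA -rmorphM /= mul_polyC coefMn coefZ coefXn.
  over.
have [rl|lr] := leqP r l.
  rewrite (bigD1 (Ordinal (rl : (r < l.+1)%N))) //= eqxx mulr1 mulrC.
  rewrite [X in _ + X]big1 ?addr0 //.
  move=> i /eqP ir; case: eqP => [E|]; rewrite ?mulr0 ?mul0rn //.
  by case: ir; apply: val_inj.
rewrite bin_small // mulr0n; apply: big1 => i _.
case: eqP => [E|]; rewrite ?mulr0 ?mul0rn //.
by move: (ltn_ord i); rewrite -E ltnS leqNgt lr.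
Qed.

End Words.

(** As r > 0, the level z occurs in s, and the bound by z then makes it the maximum. The level is an
    integer because it will be N - phi(r), which may be negative. *)
Lemma max_level (s : seq nat) (z : int) (r : nat) : (0 < r)%N ->
  all (predU (fun i : nat => i%:Z <= z) (fun i : nat => i%:Z == z)) s &&
    (count (fun i : nat => i%:Z == z) s == r) =
  (s != [::]) && (z == (\max_(i <- s) i)%:Z) && (count_mem (\max_(i <- s) i) s == r).
Proof.
move=> r0; have max_ge i : i \in s -> (i <= \max_(i <- s) i)%N.
  by move=> si; exact: (@leq_bigmax_seq _ s xpredT id).
apply/andP/andP => [[/allP sz /eqP cr]|[/andP[_ /eqP ->] cr]]; last first.
  by split => //; apply/allP => i /max_ge; rewrite /= lez_nat => ->.
have /hasP[i si /eqP iz] : has (fun i : nat => i%:Z == z) s by rewrite has_count cr.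
have mi : (\max_(i <- s) i)%N = i.
  apply/eqP; rewrite eqn_leq max_ge // andbT; apply/bigmax_leqP_seq => j /sz /=.
  by rewrite -iz lez_nat eqz_nat => + _; case/orP => // /eqP ->.
by rewrite mi -{1}iz eqxx andbT -cr -iz; split => //; case: (s) si.
Qed.

Lemma iter_num_nodeE (phi : nat -> nat) (s : seq plane_tree) : s != [::] ->
  iter_num phi (PlaneTree s) =
  let its := map (iter_num phi) s in
  let m := (\max_(i <- its) i)%N in (m + phi (count_mem m its))%N.
Proof. by case: s. Qed.

(** Each word s has a nonzero term on the right for at most one r, the multiplicity of its maximal
    iteration number m, and precisely when N = m + phi(r). This multiplicity lies between 1 and the
    length of s, hence in the range of r. *)
Lemma sum_iter_num_node (phi : nat -> nat) (R : nmodType) (W : seq (seq plane_tree))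
    (g : seq plane_tree -> R) (N : int) B :
  (forall s, s \in W -> (0 < size s <= B)%N) ->
  \sum_(s <- W | (iter_num phi (PlaneTree s))%:Z == N) g s =
  \sum_(1 <= r < B.+1) \sum_(s <- W |
     all (predU (fun U => (iter_num phi U)%:Z <= N - (phi r)%:Z)
                (fun U => (iter_num phi U)%:Z == N - (phi r)%:Z)) s &&
     (count (fun U => (iter_num phi U)%:Z == N - (phi r)%:Z) s == r)) g s.
Proof.
move=> WB; under [RHS]eq_bigr do rewrite big_mkcond; rewrite exchange_big.
rewrite big_mkcond; apply: eq_big_seq => s /WB /andP[s0 sB].
set its := map (iter_num phi) s; pose m := (\max_(i <- its) i)%N.
have its0 : its != [::] by rewrite -size_eq0 size_map -lt0n.
pose mu := count_mem m its.
have mu_gt0 : (0 < mu)%N.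
  rewrite /mu -has_count has_pred1 /m; elim: (its) its0 => [//|i [|j t] IH] _.
    by rewrite big_seq1 inE.
  rewrite big_cons; case: (leqP i (\max_(x <- j :: t) x)) => _; last by rewrite mem_head.
  by rewrite inE IH ?orbT.
have muB : (mu < B.+1)%N.
  by rewrite ltnS (leq_trans _ sB) // (leq_trans (count_size _ _)) // size_map.
rewrite iter_num_nodeE -?size_eq0 -?lt0n // -/its -/m -/mu.
transitivity (\sum_(1 <= r < B.+1)
    if (N - (phi r)%:Z == m%:Z) && (mu == r) then g s else 0).
  rewrite (bigD1_seq mu) ?iota_uniq ?mem_index_iota ?mu_gt0 //= eqxx andbT.
  rewrite [X in _ = _ + X]big1_seq ?addr0 => [|r /andP[/negPf rmu _]]; last first.
    by rewrite [mu == r]eq_sym rmu andbF.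
  by rewrite subr_eq PoszD eq_sym.
apply: eq_big_nat => r /andP[r0 _].
by have := max_level its (N - (phi r)%:Z) r0; rewrite its0 all_map count_map => ->.
Qed.

(** * Sums of weights over sets of trees and their finite truncations *)

Section TreeSum.
Variables (A : comNzRingType) (a : nat -> {fps A}).
Hypothesis a00 : fpscoef (a 0%N) 0 = 0.

(** An arbitrary predicate lets Z_N and the difference D_N be instances of the same sum. *)
Definition tree_sum (Q : pred plane_tree) : {fps A} :=
  \asum_(T | is_rpt T && Q T) weight a T.

(** The weight of a tree has no coefficient in degrees below its number of leaves, so trees outside
    [K] do not matter up to degree n. Larger trees are allowed in [K], so two different truncations
    can be compared. *)
Lemma tree_sum_modX n (K : seq plane_tree) (Q : pred plane_tree) :
  uniq K -> all is_rpt K ->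
  (forall T, is_rpt T -> (leaves T <= n)%N -> T \in K) ->
  eq_modX n.+1 (tree_sum Q) (\sum_(T <- K | Q T) weight a T).
Proof.
move=> uK /allP rK Kn k kn.
have : adic_sum_to (fun T => is_rpt T && Q T) (weight a) (tree_sum Q).
  apply: adic_summable => i; have [J JP] := finite_rpt i.
  exists J => T /andP[rT _] TJ; apply: weight_coef_eq0 => //.
  by rewrite ltnNge; apply: contra TJ; exact: JP.
move=> /(_ n.+1)[J0 /(_ (undup (J0 ++ K)))] <- //; last 2 first.
- exact: undup_uniq.
- by move=> T TJ; rewrite mem_undup mem_cat TJ.
rewrite !fpscoef_sum (bigID (mem K)) /= [X in _ + X]big1 ?addr0; last first.
  move=> T /andP[/andP[rT _] TK]; apply: weight_coef_eq0 => //.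
  apply: leq_trans kn _; rewrite ltnNge; apply: contra TK; exact: Kn.
rewrite -[LHS]big_filter -[RHS]big_filter; apply: perm_big.
apply: uniq_perm; rewrite ?filter_uniq ?undup_uniq // => T.
rewrite !mem_filter mem_undup mem_cat /=.
case TK : (T \in K); last by rewrite !andbF.
by rewrite rK // orbT !andbT.
Qed.

Lemma finite_rpt_uniq n : exists K : seq plane_tree, [/\ uniq K, all is_rpt K &
  forall T, is_rpt T -> (leaves T <= n)%N -> T \in K].
Proof.
have [J JP] := finite_rpt n; exists (undup (filter is_rpt J)); split.
- exact: undup_uniq.
- by apply/allP => T; rewrite mem_undup mem_filter => /andP[].
- by move=> T rT lT; rewrite mem_undup mem_filter rT JP.
Qed.

Lemma eq_tree_sum (Q1 Q2 : pred plane_tree) : Q1 =1 Q2 -> tree_sum Q1 = tree_sum Q2.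
Proof.
by move=> Q12; congr adic_sum; apply/funext => T; rewrite Q12.
Qed.

Lemma tree_sumU (P Q : pred plane_tree) :
  tree_sum (predU P Q) = tree_sum (fun T => P T && ~~ Q T) + tree_sum Q.
Proof.
apply: fpsP => n; have [K [uK rK KP]] := finite_rpt_uniq n.
rewrite fpscoefD !(@tree_sum_modX n K) // -fpscoefD (bigID Q) /= addrC.
congr (fpscoef (_ + _) _); apply: eq_bigl => T /=; case: (Q T); case: (P T) => //.
Qed.

End TreeSum.

(** * Decomposition of the trees at the root *)

Lemma horner_nderivn_poly (R : comNzRingType) (b : nat -> R) d B r x y :
  (d <= B)%N -> (forall i, (d < i)%N -> b i = 0) ->
  y ^+ r * (\poly_(i < d.+1) b i)^`N(r).[x] =
  \sum_(0 <= l < B.+1) b l * ((y ^+ r * x ^+ (l - r)) *+ 'C(l, r)).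
Proof.
move=> dB b0; rewrite poly_def linear_sum horner_sum mulr_sumr /=.
rewrite -(big_mkord xpredT (fun l => y ^+ r * (b l *: 'X^l)^`N(r).[x])) /=.
(* The range of l extends to [B] only to match the lengths of the words; the added terms vanish with
   [b l]. *)
rewrite [RHS](big_cat_nat (n := d.+1)) //= [X in _ = _ + X]big_nat_cond.
rewrite [X in _ = _ + X]big1 ?addr0 => [|l]; last first.
  by rewrite andbT => /andP[/b0-> _]; rewrite mul0r.
apply: eq_bigr => l _.
by rewrite linearZ /= nderivnXn hornerZ hornerMn hornerXn mulrCA -mulrnAr.
Qed.

Section TreeRecursion.
Variables (A : comNzRingType) (a : nat -> {fps A}) (phi : nat -> nat) (d : nat).
Hypothesis a00 : fpscoef (a 0%N) 0 = 0.
Hypothesis a1u : a 1%N \is a GRing.unit.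
Hypothesis a_gt : forall i, (d < i)%N -> a i = 0.
Hypothesis phi1 : phi 1 = 0%N.

Local Notation Z := (tree_series a phi).
Local Notation f := (\poly_(i < d.+1) a i).

Lemma tree_series_diff (N : int) :
  tree_sum a (fun T => (iter_num phi T)%:Z == N) = Z N - Z (N - 1).
Proof.
apply/esym/eqP; rewrite subr_eq; apply/eqP.
rewrite /Z -/(tree_sum a (fun T => (iter_num phi T)%:Z <= N)).
rewrite -/(tree_sum a (fun T => (iter_num phi T)%:Z <= N - 1)).
rewrite addrC [X in X + _](_ : _ = tree_sum a (fun T =>
  ((iter_num phi T)%:Z <= N) && ~~ ((iter_num phi T)%:Z == N))).
  rewrite -tree_sumU //; apply: eq_tree_sum => T /=; lia.
apply: eq_tree_sum => T /=; lia.
Qed.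

(** In degree n only trees with at most n leaves matter, so every sum becomes finite. The trees of
    iteration number N are then summed twice: directly over [J], and over [K] by decomposing at the
    root into words of children from [J]. *)
Lemma tree_recursion (N : int) :
  \sum_(1 <= r < d.+1) (Z (N - (phi r)%:Z) - Z (N - (phi r)%:Z - 1)) ^+ r *
      f^`N(r).[Z (N - (phi r)%:Z - 1)] = - (a 0%N *+ (N == 0)).
Proof.
apply: fpsP => n; have [J [uJ rJ JP]] := finite_rpt_uniq n.
(* [B] bounds the degree d and the number of children in a tree with at most n leaves; the successor
   ensures that the terms l = 0 and l = 1 are both in range. *)
pose B := (n + d).+1.
pose W := [seq s | l <- index_iota 2 B.+1, s <- words J l].
pose K := PlaneTree [::] :: map PlaneTree W.
have WP s : s \in W = (2 <= size s <= B)%N && all (mem J) s.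
  apply/allpairsPdep/idP => [[l [t [+ + ->]]]|/andP[sB sJ]].
    by rewrite mem_index_iota mem_words ltnS => + /andP[/eqP -> ->] => ->.
  by exists (size s), s; rewrite mem_index_iota mem_words eqxx sJ.
have uW : uniq W.
  apply: allpairs_uniq_dep; first exact: iota_uniq.
    by move=> l _; exact: words_uniq.
  move=> _ _ /allpairsPdep[l [s [_ + ->]]] /allpairsPdep[m [t [_ + ->]]] /= st.
  by rewrite !mem_words st => /andP[/eqP <- _] /andP[/eqP <- _].
have uK : uniq K.
  rewrite /= map_inj_uniq => [|s t []//]; rewrite uW andbT.
  by apply/mapP => -[s + [s0]]; rewrite WP -s0.
have rK : all is_rpt K.
  rewrite /= all_map; apply/allP => s; rewrite WP => /andP[/andP[s2 _] sJ] /=.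
  rewrite neq_ltn s2 orbT /=; apply: sub_all sJ => T TJ; exact: (allP rJ).
have KP T : is_rpt T -> (leaves T <= n)%N -> T \in K.
  case: T => -[|T1 [//|T2 Ts]]; first by rewrite mem_head.
  set s := [:: T1, T2 & Ts] => rT lT; rewrite inE; apply/orP; right.
  apply/map_f; rewrite WP.
  have lT' : (sumn (map leaves s) <= n)%N by [].
  have /allP rs : all is_rpt s by case/andP: rT.
  apply/andP; split.
    apply/andP; split => //; apply: leq_trans (size_le_leaves s) _.
    by apply: leq_trans lT' _; rewrite leqW ?leq_addr.
  apply/allP => T sT; apply: JP; first exact: rs.
  apply: leq_trans lT'; rewrite (perm_sumn (perm_map leaves (perm_to_rem sT))).
  exact: leq_addr.
pose D m := \sum_(T <- J | (iter_num phi T)%:Z == m) weight a T.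
pose Y m := \sum_(T <- J | (iter_num phi T)%:Z <= m) weight a T.
have DE m : eq_modX n.+1 (Z m - Z (m - 1)) (D m).
  by rewrite -tree_series_diff; exact: tree_sum_modX.
have YE m : eq_modX n.+1 (Z m) (Y m).
  exact: (tree_sum_modX a00 (fun T => (iter_num phi T)%:Z <= m) uJ rJ JP).
pose h l r :=
  a l * ((D (N - (phi r)%:Z) ^+ r * Y (N - (phi r)%:Z - 1) ^+ (l - r)) *+ 'C(l, r)).
(* Extending r beyond d adds nothing, since the divided derivatives of order r > d vanish. *)
have lhsE : eq_modX n.+1 (\sum_(1 <= r < d.+1)
    (Z (N - (phi r)%:Z) - Z (N - (phi r)%:Z - 1)) ^+ r *
      f^`N(r).[Z (N - (phi r)%:Z - 1)])
  (\sum_(1 <= r < B.+1) \sum_(0 <= l < B.+1) h l r).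
  rewrite [X in eq_modX _ _ X](big_cat_nat (n := d.+1)) //=; last first.
    by rewrite ltnS leqW ?leq_addl.
  rewrite [X in eq_modX _ _ (_ + X)]big_nat_cond.
  rewrite [X in eq_modX _ _ (_ + X)]big1 ?addr0; last first.
    move=> r /andP[/andP[dr _] _].
    rewrite -(horner_nderivn_poly r _ _ (leqW (leq_addl n d)) a_gt).
    have -> : f^`N(r) = 0; last by rewrite horner0 mulr0.
    apply/polyP => i; rewrite coef_nderivn coef_poly coef0 ltnNge.
    by rewrite (leq_trans dr) ?leq_addr //= mul0rn.
  apply: eq_modX_sum => r _.
  rewrite (horner_nderivn_poly r _ _ (leqW (leq_addl n d)) a_gt).
  apply: eq_modX_sum => l _; apply: eq_modXM; first exact: eq_modX_refl.
  apply: eq_modXMn.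
  by apply: eq_modXM; apply: eq_modXX; [exact: DE|exact: YE].
(* The factor a_1 clears the denominator at the root. The single vertex gives - a_0 when N = 0, and
   the roots with l >= 2 children give the double sum. *)
have nodes : \sum_(T <- K | (iter_num phi T)%:Z == N) a 1%N * weight a T =
    - (a 0%N *+ (N == 0)) - \sum_(2 <= l < B.+1) \sum_(1 <= r < B.+1) h l r.
  rewrite big_mkcond big_cons -big_mkcond.
  have wE s : a 1%N * weight a (PlaneTree s) =
      - (a (size s) * \prod_(T <- s) weight a T).
    by rewrite /= big_map mulNr mulrN mulrA [_ / _]mulrC mulVKr.
  have -> : iter_num phi (PlaneTree [::]) = 0%N by [].
  rewrite wE big_nil mulr1 eq_sym.
  congr (_ + _); first by case: eqP; rewrite ?mulr1n ?mulr0n ?oppr0.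
  rewrite big_map big_mkcond /W big_allpairs_dep -sumrN.
  apply: eq_big_nat => l /andP[l2 lB]; rewrite -big_mkcond.
  under eq_bigr do rewrite wE.
  rewrite sumrN; congr (- _).
  transitivity (a l * \sum_(s <- words J l | (iter_num phi (PlaneTree s))%:Z == N)
                   \prod_(T <- s) weight a T).
    rewrite mulr_sumr; rewrite big_seq_cond [RHS]big_seq_cond; apply: eq_bigr => s.
    by rewrite mem_words => /andP[/andP[/eqP-> _] _].
  rewrite (@sum_iter_num_node _ _ _ _ _ B) => [|s]; last first.
    by rewrite mem_words => /andP[/eqP -> _]; rewrite (ltnW l2).
  rewrite mulr_sumr; apply: eq_bigr => r _; rewrite sum_words_count.
  have -> // : \sum_(T <- J | ((iter_num phi T)%:Z <= N - (phi r)%:Z) &&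
      ~~ ((iter_num phi T)%:Z == N - (phi r)%:Z)) weight a T = Y (N - (phi r)%:Z - 1).
  by apply: eq_bigl => T; lia.
(* Since binomial(l, r) = 0 for l < r, nothing remains of l = 0, and l = 1 leaves only r = 1, where
   phi(1) = 0 yields a_1 D_N. *)
have hsum : \sum_(1 <= r < B.+1) \sum_(0 <= l < B.+1) h l r =
    a 1%N * D N + \sum_(2 <= l < B.+1) \sum_(1 <= r < B.+1) h l r.
  rewrite exchange_big.
  have split2 (G : nat -> {fps A}) : \sum_(0 <= l < B.+1) G l =
      G 0%N + G 1%N + \sum_(2 <= l < B.+1) G l.
    by rewrite big_ltn // big_ltn // addrA.
  rewrite split2; congr (_ + _).
  have h_small l r : (l < r)%N -> h l r = 0.
    by move=> lr; rewrite /h bin_small // mulr0n mulr0.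
  have -> : \sum_(1 <= r < B.+1) h 0%N r = 0.
    apply: big1_seq => r; rewrite mem_index_iota => /andP[_ /andP[r1 _]].
    exact: h_small.
  have -> : \sum_(1 <= r < B.+1) h 1%N r = h 1%N 1%N.
    rewrite big_ltn // big1_seq ?addr0 // => r.
    by rewrite mem_index_iota => /andP[_ /andP[r2 _]]; exact: h_small.
  by rewrite add0r /h phi1 subr0 subnn mulr1 expr1.
rewrite lhsE // hsum.
(* Both [J] and [K] contain all trees with at most n leaves, so a_1 times the sum in [nodes] agrees
   with a_1 [D N] in degree n; the double sums over l >= 2 then cancel. *)
have := @eq_modXM _ _ _ _ _ _ (@eq_modX_refl _ n.+1 (a 1%N))
  (tree_sum_modX a00 (fun T => (iter_num phi T)%:Z == N) uK rK KP) n (ltnSn n).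
rewrite mulr_sumr nodes tree_series_diff.
rewrite (eq_modXM (@eq_modX_refl _ n.+1 (a 1%N)) (DE N)) // !(fpscoefD, fpscoefN) => ->.
by rewrite subrK.
Qed.

End TreeRecursion.

(** * Telescoping over the levels and Taylor expansion *)

Lemma telescope_levels (V : zmodType) (s : seq nat) (phi : nat -> nat) (L : nat)
    (g : int -> V) (e : nat -> int -> V) (N : int) :
  (forall r, r \in s -> (phi r <= L)%N) ->
  (forall M, g M - g (M - 1) = \sum_(r <- s) e r M) ->
  g (N - L%:Z) + \sum_(0 <= k < L) \sum_(r <- s | (phi r <= k)%N) e r (N - k%:Z) =
  g N - \sum_(r <- s) \sum_(0 <= k < phi r) e r (N - k%:Z).
Proof.
move=> phiL ge.
(* As phi(r) <= L, the condition k < phi(r) can be read as the complement of phi(r) <= k within k <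
   L. *)
have -> : \sum_(r <- s) \sum_(0 <= k < phi r) e r (N - k%:Z) =
    \sum_(0 <= k < L) \sum_(r <- s | ~~ (phi r <= k)%N) e r (N - k%:Z).
  under [RHS]eq_bigr do rewrite big_mkcond.
  rewrite exchange_big; apply: eq_big_seq => r /phiL rL.
  rewrite [RHS](big_cat_nat (n := phi r)) //= [X in _ = _ + X]big_nat_cond.
  rewrite [X in _ = _ + X]big1 ?addr0 => [|k /andP[/andP[-> _] _] //].
  by apply: eq_big_nat => k /andP[_]; rewrite ltnNge => ->.
apply/eqP; rewrite eq_sym subr_eq -addrA -big_split /= addrC -subr_eq eq_sym.
apply/eqP.
(* The two complementary sums over r at level k add up to one increment of [g], and the increments
   telescope. *)
rewrite (eq_bigr (fun k : nat => g (N - k%:Z) - g (N - k%:Z - 1))) => [|k _]; last first.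
  by rewrite ge [RHS](bigID (fun r => (phi r <= k)%N)).
elim: L {phiL} => [|L IH]; first by rewrite big_geq // subr0 subrr.
rewrite big_nat_recr //= IH subrKA; congr (_ - g _); lia.
Qed.

(** With divided derivatives, Taylor's formula holds over any commutative ring; its term r = 0 is
    p(y). *)
Lemma horner_diff_taylor (R : comNzRingType) (p : {poly R}) n x y :
  (size p <= n)%N ->
  p.[x] - p.[y] = \sum_(1 <= r < n) (x - y) ^+ r * p^`N(r).[y].
Proof.
move=> pn; have p0 r : (size p <= r)%N -> p^`N(r) = 0.
  move=> pr; apply/polyP => i; rewrite coef_nderivn coef0.
  by rewrite nth_default ?mul0rn ?(leq_trans pr) ?leq_addr.
case: n pn => [|n] pn.
  by move: pn; rewrite leqn0 size_poly_eq0 => /eqP->; rewrite !horner0 subr0 big_geq.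
have := nderiv_taylor_wide (mulrC y (x - y)) pn; rewrite [y + _]addrC subrK => ->.
rewrite -(big_mkord xpredT (fun i => p^`N(i).[y] * (x - y) ^+ i)) big_ltn //.
rewrite nderivn0 expr0 mulr1 addrC addKr.
by apply: eq_bigr => r _; rewrite mulrC.
Qed.

Lemma horner_derivn_div_fact (d : nat) (p : {poly {fps laurent d}}) r x :
  p^`(r).[x] / r`!%:R = p^`N(r).[x].
Proof. by rewrite nderivn_def hornerMn -[X in X / _]mulr_natr mulrK ?fact_unit. Qed.

(** * The recurrence, from the vanishing of [H] on the nonnegative integers *)

Theorem theorem1 (d : nat) (phi : nat -> nat) (L : nat)
    (hd : (1 <= d)%N) (hL : (1 <= L)%N)
    (phi_image : forall m : nat,
       (exists r : nat, (1 <= r)%N /\ phi r = m) <-> (m <= L)%N)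
    (phi_zero : forall r : nat, (1 <= r)%N -> (phi r = 0%N <-> r = 1%N))
    (N : int) (hN : 0 <= N) :
  let f := gen_poly d in
  let Z := Zser d phi in
  Z N = Z (N - 1) -
    (f.[Z (N - L%:Z)] +
     \sum_(1 <= k < L)
       \asum_(r | (1 <= r)%N && (phi r <= k)%N)
         ((Z (N - k%:Z) - Z (N - k%:Z - 1)) ^+ r *
          (f^`(r).[Z (N - k%:Z - 1)] / (r`!)%:R)))
    / f^`().[Z (N - 1)].
Proof.
move=> f Z.
have u := deriv_gen_poly_unit phi (N - 1) hd.
have a1u : indet d 1 \is a GRing.unit.
  apply/fps_unitP; have [c c1] := laurent_a1_inv hd; exists c.
  by rewrite /indet /= hd.
have phi1 : phi 1 = 0%N by exact/phi_zero.
have a_gt i : (d < i)%N -> indet d i = 0.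
  by rewrite /indet; case: i => // i; rewrite ltnNge => /negPf->.
have szf : (size f <= d.+1)%N by exact: size_poly.
pose e r M := (Z M - Z (M - 1)) ^+ r * f^`N(r).[Z (M - 1)].
pose s := index_iota 1 d.+1.
pose H M := f.[Z M] - \sum_(r <- s) \sum_(0 <= k < phi r) e r (M - k%:Z).
have Zneg M : M < 0 -> Z M = 0 by exact: tree_series_neg.
have f0 : f.[0] = indet d 0 by rewrite horner_coef0 coef_poly.
have ge M : f.[Z M] - f.[Z (M - 1)] = \sum_(r <- s) e r M.
  exact: horner_diff_taylor.
have e_neg r M : (1 <= r)%N -> M < 0 -> e r M = 0.
  move=> r1 M0; rewrite /e !Zneg ?subrr ?expr0n; [|lia..].
  by rewrite gtn_eqF ?mul0r.
have Hneg : H (-1) = indet d 0.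
  rewrite /H Zneg // f0 big_seq big1 ?subr0 // => r.
  rewrite mem_index_iota => /andP[r1 _].
  by rewrite big1 // => k _; apply: e_neg => //; lia.
have Hrec M : H M - H (M - 1) = - (indet d 0 *+ (M == 0)).
  rewrite -(tree_recursion (erefl : fpscoef (indet d 0) 0 = 0) a1u a_gt phi1) -/f.
  rewrite /H opprB [X in _ + X]addrC addrACA ge [- _ + _]addrC -sumrB -big_split.
  apply: eq_bigr => r _; rewrite -/Z -[RHS]/(e r _).
  (* The sum coming from [H (M - 1)] is the one from [H M] with k shifted by one, so for each r
     everything collapses to e_r(M - phi(r)). *)
  rewrite (eq_bigr (fun k => e r (M - k.+1%:Z))); last first.
    by move=> k _; congr (e r _); lia.
  rewrite /=; elim: (phi r) => [|m IH]; first by rewrite !big_geq // subrr !addr0.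
  rewrite big_nat_recr // [X in _ - X]big_nat_recr //=.
  by rewrite opprD addrACA [LHS]addrA IH addrC subrK.
(* The jump - a_0 at 0 cancels [H (-1)], and [H] is constant afterwards. *)
have H0 (n : nat) : H n%:Z = 0.
  elim: n => [|n IH].
    have := Hrec 0; rewrite sub0r Hneg eqxx mulr1n => /eqP.
    by rewrite subr_eq addNr => /eqP.
  have := Hrec n.+1%:Z; rewrite (_ : n.+1%:Z - 1 = n%:Z) ?IH; last lia.
  by rewrite subr0 => ->; rewrite mulr0n oppr0.
have := H0 `|N|%N; rewrite gez0_abs // => {}H0.
have phiL r : r \in s -> (phi r <= L)%N.
  by rewrite mem_index_iota => /andP[r1 _]; apply/phi_image; exists r.
have := @telescope_levels _ s phi L (fun M => f.[Z M]) e N phiL ge.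
rewrite -/(H N) H0 big_ltn // subr0.
have -> : \sum_(r <- s | (phi r <= 0)%N) e r N =
    (Z N - Z (N - 1)) * f^`().[Z (N - 1)].
  rewrite /s big_ltn_cond ?ltnS // phi1 leqnn big_nat_cond big1 ?addr0 => [|r].
    by rewrite /e expr1 poly.nderivn1.
  rewrite leqn0 => /andP[/andP[r1 _] /eqP/phi_zero]; move: r1; lia.
have -> : \sum_(1 <= k < L) \sum_(r <- s | (phi r <= k)%N) e r (N - k%:Z) =
    \sum_(1 <= k < L) \asum_(r | (1 <= r)%N && (phi r <= k)%N)
         ((Z (N - k%:Z) - Z (N - k%:Z - 1)) ^+ r *
          (f^`(r).[Z (N - k%:Z - 1)] / (r`!)%:R)).
  apply: eq_bigr => k _; rewrite (@adic_sum_finite_support _ _ _ _ s) ?iota_uniq //.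
    rewrite big_seq_cond [RHS]big_seq_cond; apply: eq_big => r.
      by rewrite mem_index_iota; case: (1 <= r)%N.
    by move=> _; rewrite horner_derivn_div_fact.
  (* Outside [s] the order r exceeds d, so the derivative is zero. *)
  move=> r /andP[r1 _]; rewrite mem_index_iota r1 /= -leqNgt => dr.
  by rewrite derivn_poly0 ?horner0 ?mul0r ?mulr0 // (leq_trans szf).
(* The identity is now linear in Z_N - Z_(N-1), with the unit f'(Z_(N-1)) as coefficient. *)
rewrite addrCA => /eqP; rewrite addr_eq0 => /eqP/(canRL (mulrK u)) ZN.
by rewrite -[LHS](subrK (Z (N - 1))) ZN mulNr; exact: addrC.
Qed.
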